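(* Consider a family of discrete-time systems $x(t+1)=f_i(x(t),v(t))$, $y(t)=h_i(x(t))$, $i\in\mathcal{P}=\{1,\dots,N\}$, with index set partitioned as $\mathcal{P}=\mathcal{P}_S\sqcup\mathcal{P}_U$, a set $E(\mathcal{P})$ of admissible switches, and admissible minimum and maximum dwell times $\Delta_m$ and $\Delta_M$, subject to the standing assumptions given in the context. Let $G(\mathcal{P},E(\mathcal{P}))$ be the underlying weighted directed graph of the switched system, as defined in the context. Suppose that $G(\mathcal{P},E(\mathcal{P}))$ is nicely connected (with a monotone increasing function $\Phi:\mathbb{N}\to\mathbb{R}$) and nicely $\Delta$-weighted (with constants $\Delta,\beta,B,A,\alpha$). Then a cycle of length at least $\lfloor\Phi(|\mathcal{P}_S|)\rfloor$ on $G(\mathcal{P},E(\mathcal{P}))$ obtained from the cycle detection algorithm described in the context is $\Delta$-contractive with probability at least $$1-\exp\left(-\frac12\left(\frac{\alpha-\beta}{A+B}\right)^2\lfloor\Phi(|\mathcal{P}_S|)\rfloor\right).$$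
   Context: **Systems.** $\mathbb{N}_0=\{0,1,2,\dots\}$; $\|\cdot\|$ is the Euclidean norm; $\lfloor y\rfloor$ is the largest integer $\le y$; $[\Delta_m:\Delta_M]$ is the set of integers from $\Delta_m$ to $\Delta_M$, where $\Delta_m$ and $\Delta_M$ are the admissible minimum and maximum dwell times on each subsystem. The family of systems is $x(t+1)=f_i(x(t),v(t))$, $x(0)=x_0$, $y(t)=h_i(x(t))$, $t\in\mathbb{N}_0$, $i\in\mathcal{P}=\{1,\dots,N\}$, with $x(t)\in\mathbb{R}^d$, $v(t)\in\mathbb{R}^m$, $y(t)\in\mathbb{R}^p$ the states, inputs and outputs, and $\ker f_i(\cdot,0)=\{0\}$ for each $i$. A switching signal $\sigma:\mathbb{N}_0\to\mathcal{P}$ generates the switched system $x(t+1)=f_{\sigma(t)}(x(t),v(t))$, $y(t)=h_{\sigma(t)}(x(t))$. $\mathcal{P}_S$ and $\mathcal{P}_U$ are the sets of indices of the input/output-to-state stable (IOSS) and the unstable subsystems, $\mathcal{P}=\mathcal{P}_S\sqcup\mathcal{P}_U$. $E(\mathcal{P})$ is the set of ordered pairs $(i,j)$, $i,j\in\mathcal{P}$, $i\ne j$, such that a switch from subsystem $i$ to subsystem $j$ is admissible. **Standing Lyapunov assumptions.** For each $i\in\mathcal{P}$ there are continuous functions $V_i:\mathbb{R}^d\to[0,+\infty[$, class $\mathcal{K}_\infty$ functions $\underline\alpha,\overline\alpha$, class $\mathcal{K}$ functions $\gamma_1,\gamma_2$, and scalars $\lambda_i$ with $0<\lambda_i<1$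 for $i\in\mathcal{P}_S$ and $\lambda_i>1$ for $i\in\mathcal{P}_U$, such that for all $\xi\in\mathbb{R}^d$, $\eta\in\mathbb{R}^m$: $\underline\alpha(\|\xi\|)\le V_i(\xi)\le\overline\alpha(\|\xi\|)$ and $V_i(f_i(\xi,\eta))\le\lambda_iV_i(\xi)+\gamma_1(\|\eta\|)+\gamma_2(\|h_i(\xi)\|)$. For each $(i,j)\in E(\mathcal{P})$ there is $\mu_{ij}\ge1$ with $V_j(\xi)\le\mu_{ij}V_i(\xi)$ for all $\xi\in\mathbb{R}^d$. **Underlying weighted directed graph $G(\mathcal{P},E(\mathcal{P}))$.** Vertex set $\mathcal{P}$, directed edge set $E(\mathcal{P})$; vertex weights $w(j)=-|\ln\lambda_j|$ for $j\in\mathcal{P}_S$ and $w(j)=|\ln\lambda_j|$ for $j\in\mathcal{P}_U$; edge weights $w(i,j)=\ln\mu_{ij}$ for $(i,j)\in E(\mathcal{P})$. The weights are treated as random variables; the sets $\mathcal{P}_S,\mathcal{P}_U,E(\mathcal{P})$ are deterministic. **Cycles, $\Delta$-contractivity.** A cycle is a closed walk $W=v_0,(v_0,v_1),v_1,\dots,v_{n-1},(v_{n-1},v_0),v_0$ with $v_0,\dots,v_{n-1}$ distinct and all edges in $E(\mathcal{P})$; its length is $n$. It is $\Delta$-contractive if there exist $\Delta_{v_k}\in[\Delta_m:\Delta_M]$, $k=0,\dots,n-1$, such that, with $v_n:=v_0$, $$\sum_{k=0}^{n-1}w(v_k)\Delta_{v_k}+\sum_{k=0}^{n-1}w(v_k,v_{k+1})<0.$$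 **Nicely connected.** For $v\in\mathcal{P}$ let $N^+_{\mathcal{P}_S}(v)=\{u\in\mathcal{P}_S:(v,u)\in E(\mathcal{P})\}$ and $d^+_{\mathcal{P}_S}(v)=|N^+_{\mathcal{P}_S}(v)|$. Given a monotone increasing $\Phi:\mathbb{N}\to\mathbb{R}$, the graph is nicely connected if $d^+_{\mathcal{P}_S}(j)\ge\lfloor\Phi(|\mathcal{P}_S|)\rfloor$ for all $j\in\mathcal{P}$. **Nicely $\Delta$-weighted.** The graph is nicely $\Delta$-weighted if: (1) there exist $\Delta\in[\Delta_m:\Delta_M]$ and $0<\beta<B$ such that $0<|w(j)|\Delta\le B$ and $\mathrm{E}\big[|w(j)|\Delta\,\big|\,\{|w(\ell)|\Delta\}_{\ell\ne j},\{w(k,\ell)\}_{(k,\ell)\in E(\mathcal{P})}\big]=\beta$ for all $j\in\mathcal{P}$; and (2) there exist constants $A>0$ and $\alpha<\beta$ such that for every $(i,j)\in E(\mathcal{P})$, $w(i,j)\in[-A,A]$ and $\mathrm{E}\big[w(i,j)\,\big|\,\{|w(\ell)|\Delta\}_{\ell\in\mathcal{P}},\{w(k,\ell)\}_{(k,\ell)\ne(i,j)}\big]\le\alpha$. **Cycle detection algorithm.** Pick $v_0\in\mathcal{P}_S$ uniformly at random; set $k=0$. While $N^+_{\mathcal{P}_S}(v_k)\setminus\{v_0,\dots,v_k\}\ne\emptyset$, pick $v_{k+1}$ in this set uniformly at random and increase $k$ by 1. When this set is empty, pick $v_{k+1}=v_i$ with $v_i\in N^+_{\mathcal{P}_S}(v_k)$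 and $k-i$ maximum, and stop. The cycle obtained is $v_i,v_{i+1},\dots,v_k,v_i$ (relabelled to start at $v_0$). The random choices of the algorithm are made independently of the weights. *)

(* Defs.v *)
From HB Require Import structures.
From mathcomp Require Import all_boot all_order all_algebra.
From mathcomp Require Import all_classical all_reals all_analysis.

Set Implicit Arguments.
Unset Strict Implicit.
Unset Printing Implicit Defensive.

Import Order.TTheory GRing.Theory Num.Theory.
Import numFieldNormedType.Exports.

Local Open Scope classical_set_scope.
Local Open Scope ring_scope.

(* The library norm on matrices is the sup norm, hence this definition. *)
Definition enorm (R : realType) (n : nat) (x : 'cV[R]_n) : R :=
  Num.sqrt (\sum_(k < n) x k ord0 ^+ 2).

(* Comparison functions [0,+oo[ -> [0,+oo[ are represented by functions R -> R
   of which only the values on [0,+oo[ matter. *)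
Definition class_K (R : realType) (a : R -> R) : Prop :=
  [/\ {within `[0, +oo[, continuous a},
      a 0 = 0 &
      forall s t : R, 0 <= s -> s < t -> a s < a t].

Definition class_Kinfty (R : realType) (a : R -> R) : Prop :=
  class_K a /\ a s @[s --> +oo] --> +oo.

(* The Lyapunov assumptions on one family of systems
   x(t+1) = f_i(x(t), v(t)), y(t) = h_i(x(t)), with the scalars lambda_i and
   mu_ij; the comparison functions do not depend on i. *)
Definition lyapunov_assumptions (R : realType) (N d m p : nat)
    (PS PU : {set 'I_N}) (E : {set 'I_N * 'I_N})
    (f : 'I_N -> 'cV[R]_d -> 'cV[R]_m -> 'cV[R]_d)
    (h : 'I_N -> 'cV[R]_d -> 'cV[R]_p)
    (lambda : 'I_N -> R) (mu : 'I_N * 'I_N -> R) : Prop :=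
  exists (V : 'I_N -> 'cV[R]_d -> R) (alpha_lo alpha_up gamma1 gamma2 : R -> R),
  [/\ [/\ class_Kinfty alpha_lo, class_Kinfty alpha_up,
          class_K gamma1 & class_K gamma2],
      forall i, continuous (V i) /\ (forall xi, 0 <= V i xi),
      (forall i, i \in PS -> 0 < lambda i < 1) /\
      (forall i, i \in PU -> 1 < lambda i),
      forall i xi eta,
        [/\ alpha_lo (enorm xi) <= V i xi,
            V i xi <= alpha_up (enorm xi) &
            V i (f i xi eta) <=
              lambda i * V i xi + gamma1 (enorm eta) + gamma2 (enorm (h i xi))] &
      forall i j, (i, j) \in E ->
        1 <= mu (i, j) /\ (forall xi, V j xi <= mu (i, j) * V i xi)].

Definition vertex_weight (R : realType) (T : Type) (N : nat) (PS : {set 'I_N})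
    (lambda : 'I_N -> T -> R) (j : 'I_N) (x : T) : R :=
  if j \in PS then - `|ln (lambda j x)| else `|ln (lambda j x)|.

Definition edge_weight (R : realType) (T : Type) (N : nat)
    (mu : 'I_N * 'I_N -> T -> R) (e : 'I_N * 'I_N) (x : T) : R :=
  ln (mu e x).

(* The closed walk v_0, ..., v_(n-1), v_0 is represented by the sequence
   [:: v_0; ...; v_(n-1)], so that its length is the size of the sequence. *)
Definition is_cycle (N : nat) (E : {set 'I_N * 'I_N}) (c : seq 'I_N) : bool :=
  [&& (0 < size c)%N, uniq c & cycle (fun i j => (i, j) \in E) c].

(* As the vertices of a cycle are distinct, the dwell times and the successor
   on the cycle can be indexed by the vertices themselves. *)
Definition contractive (R : realType) (N : nat) (Dmin Dmax : nat)
    (wv : 'I_N -> R) (we : 'I_N * 'I_N -> R) (c : seq 'I_N) : Prop :=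
  exists D : 'I_N -> nat,
    (forall v, v \in c -> (Dmin <= D v <= Dmax)%N) /\
    \sum_(v <- c) wv v * (D v)%:R + \sum_(v <- c) we (v, next c v) < 0.

Definition out_nbrs (N : nat) (PS : {set 'I_N}) (E : {set 'I_N * 'I_N})
    (v : 'I_N) : {set 'I_N} :=
  [set u in PS | (v, u) \in E].

Definition nicely_connected (R : realType) (N : nat) (PS : {set 'I_N})
    (E : {set 'I_N * 'I_N}) (Phi : nat -> R) : Prop :=
  forall j : 'I_N, Num.floor (Phi #|PS|) <= #|out_nbrs PS E j|%:Z.

Definition family_preimages (R : realType) (T I : Type) (D : set I)
    (X : I -> T -> R) : set_system T :=
  \bigcup_(i in D) preimage_set_system setT (X i) measurable.

(* Y is a version of the conditional expectation of X given the
   sigma-algebra G. *)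
Definition is_cond_expectation (R : realType) (dsp : measure_display)
    (T : measurableType dsp) (P : probability T R) (G : set_system T)
    (X Y : T -> R) : Prop :=
  [/\ P.-integrable setT (EFin \o X),
      P.-integrable setT (EFin \o Y),
      preimage_set_system setT Y measurable `<=` G &
      forall A, G A ->
        (\int[P]_(x in A) (Y x)%:E = \int[P]_(x in A) (X x)%:E)%E].

(* Relations between random variables hold almost surely. *)
Definition nicely_weighted (R : realType) (dsp : measure_display)
    (T : measurableType dsp) (P : probability T R) (N : nat)
    (E : {set 'I_N * 'I_N}) (Dmin Dmax : nat)
    (wv : 'I_N -> T -> R) (we : 'I_N * 'I_N -> T -> R)
    (Delta : nat) (beta B A alpha : R) : Prop :=
  let dwell_wv (l : 'I_N) (x : T) : R := `|wv l x| * Delta%:R in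
  [/\ (Dmin <= Delta <= Dmax)%N,
      0 < beta /\ beta < B,
      forall j : 'I_N,
        (\forall x \ae P, 0 < dwell_wv j x /\ dwell_wv j x <= B) /\
        (exists Y : T -> R,
          is_cond_expectation P
            <<s family_preimages [set l | l != j] dwell_wv `|`
                family_preimages [set e | e \in E] we >>
            (dwell_wv j) Y /\
          \forall x \ae P, Y x = beta),
      0 < A /\ alpha < beta &
      forall e : 'I_N * 'I_N, e \in E ->
        (\forall x \ae P, - A <= we e x /\ we e x <= A) /\
        (exists Y : T -> R,
          is_cond_expectation P
            <<s family_preimages setT dwell_wv `|`
                family_preimages [set e' | e' \in E /\ e' != e] we >>
            (we e) Y /\
          \forall x \ae P, Y x <= alpha)].

(* Probability that, after visiting the vertices in [visited] and being
   currently at v, the while loop of the algorithm successively picks exactly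
   the vertices of s and then exits. *)
Fixpoint loop_prob (R : realType) (N : nat) (PS : {set 'I_N})
    (E : {set 'I_N * 'I_N}) (visited : {set 'I_N}) (v : 'I_N)
    (s : seq 'I_N) : R :=
  let avail := out_nbrs PS E v :\: visited in
  match s with
  | [::] => if avail == finset.set0 then 1 else 0
  | u :: s' =>
      if u \in avail
      then (#|avail|%:R)^-1 * loop_prob R PS E (u |: visited) u s'
      else 0
  end.

(* Law of the sequence v_0, ..., v_k of vertices visited by the algorithm
   when the while loop exits. *)
Definition trace_prob (R : realType) (N : nat) (PS : {set 'I_N})
    (E : {set 'I_N * 'I_N}) (s : seq 'I_N) : R :=
  match s with
  | [::] => 0
  | v0 :: s' =>
      if v0 \in PS
      then (#|PS|%:R)^-1 * loop_prob R PS E [set v0]%SET v0 s'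
      else 0
  end.

(* The last step of the algorithm: the cycle v_i, ..., v_k for the least i such
   that v_i is an out-neighbour of v_k in PS. It is empty (not a cycle) for a
   trace ending at a vertex without out-neighbours in PS. *)
Definition closing_cycle (N : nat) (PS : {set 'I_N}) (E : {set 'I_N * 'I_N})
    (s : seq 'I_N) : seq 'I_N :=
  match s with
  | [::] => [::]
  | v0 :: s' => drop (find (fun u => u \in out_nbrs PS E (last v0 s')) s) s
  end.

(* The random sequence tr is the sequence of vertices visited by a run of the
   algorithm whose random choices are independent of the weights. *)
Definition detection_run (R : realType) (dsp : measure_display)
    (T : measurableType dsp) (P : probability T R) (N : nat)
    (PS : {set 'I_N}) (E : {set 'I_N * 'I_N})
    (wv : 'I_N -> T -> R) (we : 'I_N * 'I_N -> T -> R)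
    (tr : T -> seq 'I_N) : Prop :=
  let sigma_tr : set_system T := preimage_set_system setT tr [set: set (seq 'I_N)] in
  [/\ sigma_tr `<=` measurable,
      forall s : seq 'I_N, P [set x | tr x = s] = (trace_prob R PS E s)%:E &
      forall F G : set T, sigma_tr F ->
        <<s family_preimages setT wv `|`
            family_preimages [set e | e \in E] we >> G ->
        P (F `&` G) = (P F * P G)%E].

(* Main.v *)
Require Import Defs.
From HB Require Import structures.
From mathcomp Require Import all_boot all_order all_algebra.
From mathcomp Require Import all_classical all_reals all_analysis.
From mathcomp Require Import measurable_realfun ring lra.
Import Order.TTheory GRing.Theory Num.Theory.
Import numFieldNormedType.Exports.
Local Open Scope classical_set_scope.
Local Open Scope ring_scope.

(* Conditionally on the trace of the algorithm, which is independent of the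
   weights, the output is a fixed cycle [c] inside [PS] whose length is at least the
   out-degree of the last visited vertex. Taking all dwell times equal to
   [Delta], [c] can only fail to be contractive if the sum [S] over [c] of
   [w(v, next v) - |w(v)| Delta] is nonnegative. The exponential moment of [t S]
   is bounded by integrating out the 2|c| weights one at a time, each
   conditionally on all the others, with Hoeffding's lemma: an edge weight
   contributes [exp(t alpha + (t A)^2 / 2)] and a vertex weight
   [exp(- t beta + (t B / 2)^2 / 2)]. Since [A^2 + B^2 / 4 <= (A + B)^2], Markov's
   inequality at [t = (beta - alpha) / (A + B)^2] gives the bound. *)

(** * Hoeffding's lemma for a single bounded variable *)

Lemma is_derive_ge0_le (R : realType) (f df : R -> R) (a : R) :
  (forall x, a <= x -> is_derive x 1 f (df x)) ->
  (forall x, a <= x -> 0 <= df x) ->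
  forall x, a <= x -> f a <= f x.
Proof.
move=> f_df df_ge0 x ax.
have cf : {within `[a, x], continuous f}.
  apply: derivable_within_continuous => y; rewrite in_itv/= => /andP[ay _].
  by have [] := f_df y ay.
have f_df' y : y \in `]a, x[%R -> is_derive y 1 f (df y).
  by rewrite in_itv/= => /andP[/ltW ay _]; exact: f_df.
have [c + fxa] := MVT_segment ax f_df' cf.
rewrite in_itv/= => /andP[ac _].
by rewrite -subr_ge0 fxa mulr_ge0 ?subr_ge0// df_ge0.
Qed.

(* The logarithm of the left-hand side has first derivative [r], where
   [r = N / Q] satisfies [r 0 = a] and [r' = 1 - r ^+ 2 <= 1]. *)
Lemma two_point_mgf_le_bounded (R : realType) (a u : R) : -1 <= a <= 1 -> 0 <= u ->
  (1 + a) / 2 * expR u + (1 - a) / 2 * expR (- u) <= expR (a * u + u ^+ 2 / 2).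
Proof.
move=> /andP[aN1 a1] u0.
pose Q x : R := (1 + a) / 2 * expR x + (1 - a) / 2 * expR (- x).
pose N x : R := (1 + a) / 2 * expR x - (1 - a) / 2 * expR (- x).
have Q0 : Q 0 = 1 by rewrite /Q oppr0 expR0; field.
have N0 : N 0 = a by rewrite /N oppr0 expR0; field.
have Q_gt0 x : 0 < Q x.
  have e1 := expR_gt0 x; have e2 := expR_gt0 (- x).
  (* At [a = -1] the first coefficient vanishes and positivity comes from the second term; otherwise
     the first term is positive. *)
  rewrite /Q; have [->|aN1'] := eqVneq a (-1).
    by rewrite subrr mul0r mul0r add0r mulr_gt0//; lra.
  apply: ltr_pwDl; last by rewrite mulr_ge0 ?(ltW e2)//; lra.
  have {}aN1' : -1 < a by rewrite lt_neqAle eq_sym aN1'.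
  by rewrite mulr_gt0//; lra.
have dQ (x : R) : is_derive x 1 Q (N x).
  by rewrite /Q; apply: is_derive_eq; rewrite /N /GRing.scale/=; ring.
have dN (x : R) : is_derive x 1 N (Q x).
  by rewrite /N; apply: is_derive_eq; rewrite /Q /GRing.scale/=; ring.
(* [g] is the derivative of [F] below, the logarithm of the right-hand side over the left-hand side.
   It vanishes at 0 and, as [N] and [Q] are derivatives of each other, [g' = (N / Q) ^+ 2]. *)
pose g (y : R) := y + a - N y / Q y.
have g_ge0 : forall x : R, 0 <= x -> 0 <= g x.
  have g0 : g 0 = 0 by rewrite /g Q0 N0; field.
  rewrite -{2}g0.
  apply: (@is_derive_ge0_le _ g (fun y => (N y / Q y) ^+ 2)) => y y0; last exact: sqr_ge0.
  have Qy0 : Q y != 0 by rewrite gt_eqF.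
  have dV := is_deriveV Qy0 (dQ y).
  by apply: is_derive_eq; rewrite /GRing.scale/=; field.
pose F (y : R) := a * y + y ^+ 2 / 2 - ln (Q y).
have : F 0 <= F u.
  apply: (@is_derive_ge0_le _ F g) => // y y0.
  have dlnQ : is_derive y 1 (fun z => ln (Q z)) (N y / Q y).
    have h := is_derive1_comp (is_derive1_ln (Q_gt0 y)) (dQ y).
    by apply: is_derive_eq; rewrite mulrC.
  by apply: is_derive_eq; rewrite /g /GRing.scale/=; field; rewrite gt_eqF.
rewrite /F Q0 ln1 mulr0 expr0n mul0r add0r subrr subr_ge0 => h.
by rewrite -[leLHS]/(Q u) -[leLHS]lnK ?posrE ?Q_gt0// ler_expR.
Qed.

(** [a] is unrestricted because it will be the normalized position of a mere upper bound of the
    conditional mean, which may lie outside the range of the variable. Outside [[-1, 1]] one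
    coefficient is negative; bounding its exponential from below by [1 + x <= expR x], after
    factoring out the other one, already gives the bound [expR (a * u)]. *)
Lemma two_point_mgf_le (R : realType) (a u : R) : 0 <= u ->
  (1 + a) / 2 * expR u + (1 - a) / 2 * expR (- u) <= expR (a * u + u ^+ 2 / 2).
Proof.
move=> u0.
have [aN1|aN1] := leP (-1) a; last first.
  have e_u : expR u = expR (- u) * expR (2 * u).
    by rewrite -expRD; congr expR; ring.
  have h1 := expR_ge1Dx (2 * u).
  have h2 := expR_ge1Dx ((1 + a) * u).
  have lin : (1 + a) / 2 * expR (2 * u) + (1 - a) / 2 <= expR ((1 + a) * u).
    by apply: le_trans h2; nra.
  have -> : (1 + a) / 2 * expR u + (1 - a) / 2 * expR (- u) =
            ((1 + a) / 2 * expR (2 * u) + (1 - a) / 2) * expR (- u).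
    by rewrite e_u; ring.
  apply: (le_trans (ler_wpM2r (expR_ge0 _) lin)).
  rewrite -expRD ler_expR.
  have := sqr_ge0 u; lra.
have [a1|a1] := leP a 1; first by apply: two_point_mgf_le_bounded; rewrite ?aN1.
have e_u : expR (- u) = expR u * expR (- 2 * u).
  by rewrite -expRD; congr expR; ring.
have h1 := expR_ge1Dx (- 2 * u).
have h2 := expR_ge1Dx ((a - 1) * u).
have lin : (1 + a) / 2 + (1 - a) / 2 * expR (- 2 * u) <= expR ((a - 1) * u).
  by apply: le_trans h2; nra.
have -> : (1 + a) / 2 * expR u + (1 - a) / 2 * expR (- u) =
          ((1 + a) / 2 + (1 - a) / 2 * expR (- 2 * u)) * expR u.
  by rewrite e_u; ring.
apply: (le_trans (ler_wpM2r (expR_ge0 _) lin)).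
rewrite -expRD ler_expR.
have := sqr_ge0 u; lra.
Qed.

(** Convexity of the exponential: [u * w] is the barycentre of [u] and [- u] with weights
    [(1 + w) / 2] and [(1 - w) / 2]. Averaging the tangent inequality at [u * w] over these two
    points cancels its linear term. *)
Lemma expR_le_chord (R : realType) (u w : R) : -1 <= w <= 1 ->
  expR (u * w) <= (1 + w) / 2 * expR u + (1 - w) / 2 * expR (- u).
Proof.
move=> /andP[wN1 w1].
have tangent v : expR (u * w) * (1 + (v - u * w)) <= expR v.
  have -> : expR v = expR (u * w) * expR (v - u * w).
    by rewrite -expRD; congr expR; ring.
  by rewrite ler_wpM2l ?expR_ge0 ?expR_ge1Dx.
have hp : 0 <= (1 + w) / 2 by lra.
have hm : 0 <= (1 - w) / 2 by lra.
apply: le_trans (lerD (ler_wpM2l hp (tangent u)) (ler_wpM2l hm (tangent (- u)))).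
by rewrite le_eqVlt; apply/orP; left; apply/eqP; field.
Qed.

(* Hoeffding's lemma for a variable with values in [c - r, c + r], as a pair
   consisting of an affine majorant and of a bound on its value at the mean. *)
Lemma expR_affine_majorant (R : realType) (c r t : R) : 0 < r -> 0 <= t ->
  exists k b : R, [/\ 0 <= b,
    forall z, c - r <= z <= c + r -> expR (t * z) <= k + b * z &
    forall m, k + b * m <= expR (t * m + (t * r) ^+ 2 / 2)].
Proof.
move=> r0 t0; pose u := t * r.
have u0 : 0 <= u by rewrite mulr_ge0// ltW.
have r_neq0 : r != 0 by rewrite gt_eqF.
(* [k + b * z] is the chord of [expR (t * z)] over [[c - r, c + r]]. *)
pose b := expR (t * c) * (expR u - expR (- u)) / (2 * r).
pose k := expR (t * c) * (expR u + expR (- u)) / 2 - b * c.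
have kbE z : k + b * z = expR (t * c) *
    ((1 + (z - c) / r) / 2 * expR u + (1 - (z - c) / r) / 2 * expR (- u)).
  by rewrite /k /b; field.
exists k, b; split.
- rewrite /b divr_ge0 ?mulr_ge0 ?expR_ge0 ?(ltW r0)// subr_ge0 ler_expR; lra.
- move=> z /andP[z1 z2]; rewrite kbE.
  have -> : t * z = t * c + u * ((z - c) / r) by rewrite /u; field.
  rewrite expRD ler_wpM2l ?expR_ge0// expR_le_chord//.
  by rewrite ler_pdivlMr// ler_pdivrMr//; apply/andP; split; lra.
- move=> m; rewrite kbE.
  have -> : t * m + u ^+ 2 / 2 = t * c + ((m - c) / r * u + u ^+ 2 / 2).
    by rewrite /u; field.
  by rewrite [leRHS]expRD ler_wpM2l ?expR_ge0// two_point_mgf_le.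
Qed.

(** * Integration relative to a sub-sigma-algebra, and the conditional form of Hoeffding's lemma *)

Lemma measurable_fun_sub_sigma (d d' : measure_display) (T : measurableType d)
    (U : measurableType d') (F : set_system T) (f : g_sigma_algebraType F -> U) :
  <<s F >> `<=` measurable -> measurable_fun setT f ->
  measurable_fun (setT : set T) f.
Proof. by move=> F_sub mf _ B mB; apply: F_sub; exact: mf. Qed.

Import HBNNSimple.

(** Plays the role of pulling a known factor out of a conditional expectation. The inequality on
    sets gives it for simple weights, and monotone convergence extends it to [W]. *)
Lemma ge0_le_integral_weighted (d : measure_display) (T : measurableType d)
    (R : realType) (mu : {measure set T -> \bar R}) (F : set_system T)
    (f1 f2 : T -> R) (W : g_sigma_algebraType F -> R) :
  <<s F >> `<=` measurable ->
  measurable_fun setT f1 -> measurable_fun setT f2 ->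
  (forall x, 0 <= f1 x) -> (forall x, 0 <= f2 x) ->
  (forall A, <<s F >> A ->
    (\int[mu]_(x in A) (f1 x)%:E <= \int[mu]_(x in A) (f2 x)%:E)%E) ->
  measurable_fun setT W ->
  (forall x, 0 <= W x) ->
  (\int[mu]_x (W x * f1 x)%:E <= \int[mu]_x (W x * f2 x)%:E)%E.
Proof.
move=> F_sub mf1 mf2 f1_ge0 f2_ge0 f12 mW W_ge0.
(* The approximation is taken over the generated sigma-algebra, not over that of [T], so that the
   level sets of each [h n] belong to [<<s F >>]. *)
pose EW : g_sigma_algebraType F -> \bar R := EFin \o W.
have mEW : measurable_fun setT EW by exact/measurable_EFinP.
pose h := nnsfun_approx measurableT mEW.
have mh n : measurable_fun (setT : set T) (h n).
  by apply: (@measurable_fun_sub_sigma _ _ _ _ F (h n)).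
have h_ge0 n x : 0 <= h n x by exact: fun_ge0.
have cvg_h (f : T -> R) : measurable_fun setT f -> (forall x, 0 <= f x) ->
    (\int[mu]_x (h n x * f x)%:E)%E @[n --> \oo] --> (\int[mu]_x (W x * f x)%:E)%E.
  move=> mf f_ge0.
  have -> : (fun x => (W x * f x)%:E) = (fun x => limn (fun n => (h n x * f x)%:E)).
    apply/funext => x; apply/esym/cvg_lim => //.
    under eq_fun do rewrite EFinM.
    rewrite EFinM; apply: cvgeZr => //.
    by apply: (cvg_nnsfun_approx measurableT mEW) => // y _; rewrite lee_fin.
  apply: cvg_monotone_convergence => //.
  - by move=> n; apply/measurable_EFinP; exact: measurable_funM.
  - by move=> n x _; rewrite lee_fin mulr_ge0.
  - move=> x _ m n mn; rewrite lee_fin ler_wpM2r//.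
    by have /lefP := nd_nnsfun_approx measurableT mEW mn; exact.
(* The integral splits over the finitely many level sets of [h n], on each of which [f12]
   applies. *)
have le_h n : (\int[mu]_x (h n x * f1 x)%:E <= \int[mu]_x (h n x * f2 x)%:E)%E.
  have Fh y : <<s F >> (h n @^-1` [set y]).
    by have : measurable (h n @^-1` [set y]) by [].
  have h_simple (f : T -> R) : measurable_fun setT f -> (forall x, 0 <= f x) ->
    (\int[mu]_x (h n x * f x)%:E = \sum_(y \in range (h n))
       y%:E * \int[mu]_(x in h n @^-1` [set y]) (f x)%:E)%E.
    move=> mf f_ge0.
    have mhy y : measurable (h n @^-1` [set y] : set T) by exact: F_sub.
    transitivity (\int[mu]_x (\sum_(y \in range (h n))
        (y * \1_(h n @^-1` [set y]) x * f x)%:E))%E.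
      apply: eq_integral => x _.
      by rewrite [in LHS](fimfunE (h n)) !fsbig_finite//= mulr_suml sumEFin.
    rewrite ge0_integral_fsum//=.
    - apply: eq_fsbigr => y; rewrite inE => -[z _ <-].
      rewrite [in RHS]integral_mkcond -ge0_integralZl//.
      + apply: eq_integral => x _; rewrite patchE indicE.
        by case: ifPn => _; rewrite ?mulr1 ?mulr0 ?mul0r ?mule0.
      + by apply/(measurable_restrictT _ _).1 => //; apply/measurable_EFinP;
          exact: measurable_funS mf.
      + by move=> x _; apply: erestrict_ge0 => t _; rewrite lee_fin.
      + by rewrite lee_fin.
    - move=> y; apply/measurable_EFinP; apply: measurable_funM => //.
      by apply: measurable_funM => //; exact: measurable_indic.
    - move=> y x _; rewrite lee_fin mulr_ge0//.
      by have := nnfun_muleindic_ge0 (h n) y x; rewrite -EFinM lee_fin.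
  rewrite !h_simple// !fsbig_finite//=.
  rewrite big_seq [leRHS]big_seq; apply: lee_sum => y.
  rewrite in_fset_set// inE => -[z _ <-].
  by rewrite lee_wpmul2l ?lee_fin// f12.
by apply: lee_cvg_to (cvg_h _ mf1 f1_ge0) (cvg_h _ mf2 f2_ge0) _; exact: nearW.
Qed.

(** No sign is assumed on [f] and [g]: the difference [g - f] agrees almost everywhere with its
    absolute value, whose integral is nonnegative. *)
Lemma ae_le_integral (d : measure_display) (T : measurableType d)
    (R : realType) (mu : {measure set T -> \bar R}) (D : set T) (f g : T -> R) :
  measurable D ->
  mu.-integrable D (EFin \o f) -> mu.-integrable D (EFin \o g) ->
  (\forall x \ae mu, f x <= g x) ->
  (\int[mu]_(x in D) (f x)%:E <= \int[mu]_(x in D) (g x)%:E)%E.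
Proof.
move=> mD intf intg fg.
have intgf : mu.-integrable D (EFin \o (fun x => g x - f x)).
  have := integrableB mD intg intf.
  by apply: eq_integrable => // x _ /=; rewrite EFinB.
rewrite -sube_ge0; last first.
  by apply/orP; left; exact: integrable_fin_num.
rewrite -integralB_EFin//.
rewrite (_ : integral _ _ _ = \int[mu]_(x in D) `|(g x - f x)%:E|)%E.
  exact: integral_ge0.
apply: ae_eq_integral => //.
- exact: measurable_int intgf.
- by apply: measurableT_comp => //; exact: measurable_int intgf.
- apply: filterS fg => x fgx _.
  by rewrite -EFinB gee0_abs// lee_fin subr_ge0.
Qed.

(** Needed because the vertex terms [|w(v)| Delta] enter the exponent with a minus sign. *)
Lemma is_cond_expectationN (R : realType) (dsp : measure_display)
    (T : measurableType dsp) (P : probability T R) (F : set_system T)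
    (X Y : T -> R) :
  <<s F >> `<=` measurable ->
  is_cond_expectation P <<s F >> X Y ->
  is_cond_expectation P <<s F >> (fun x => - X x) (fun x => - Y x).
Proof.
move=> F_sub [intX intY mY XY]; split.
- exact: (integrableN intX : P.-integrable _ (EFin \o _)).
- exact: (integrableN intY : P.-integrable _ (EFin \o _)).
- move=> A [B mB <-]; apply: mY; exists (-%R @^-1` B) => //.
  by rewrite -[X in measurable X]setTI; exact: oppr_measurable.
- move=> A FA; have mA := F_sub _ FA.
  have int_A (Z : T -> R) : P.-integrable setT (EFin \o Z) ->
      (\int[P]_(x in A) (- Z x)%:E = - \int[P]_(x in A) (Z x)%:E)%E.
    move=> intZ.
    have intAZ : P.-integrable A (EFin \o Z) by exact: integrableS intZ.
    rewrite -mulN1e -integralZl//.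
    by apply: eq_integral => x _; rewrite mulN1e.
  by rewrite !int_A// XY.
Qed.

(** The exponential is replaced by its affine majorant, then [X] by [Y] through the defining
    property of the conditional expectation on [A], then [Y] by its bound [m]. *)
Lemma cond_expectation_mgf_le (R : realType) (dsp : measure_display)
    (T : measurableType dsp) (P : probability T R) (F : set_system T)
    (X Y : T -> R) (c r m t : R) :
  <<s F >> `<=` measurable ->
  is_cond_expectation P <<s F >> X Y ->
  0 < r -> 0 <= t ->
  (\forall x \ae P, c - r <= X x <= c + r) ->
  (\forall x \ae P, Y x <= m) ->
  forall A, <<s F >> A ->
    (\int[P]_(x in A) (expR (t * X x))%:E <=
     \int[P]_(x in A) (expR (t * m + (t * r) ^+ 2 / 2))%:E)%E.
Proof.
move=> F_sub [intX intY _ XY] r0 t0 Xcr Ym A FA.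
have mA := F_sub _ FA.
have [k [b [b0 maj kbm]]] := expR_affine_majorant _ c _ _ r0 t0.
have intAX : P.-integrable A (EFin \o X) by exact: integrableS intX.
have intAY : P.-integrable A (EFin \o Y) by exact: integrableS intY.
have int_cst a : P.-integrable A (EFin \o cst a).
  exact: finite_measure_integrable_cst.
have int_aff (Z : T -> R) : P.-integrable A (EFin \o Z) ->
    P.-integrable A (EFin \o (fun x => k + b * Z x)).
  move=> intZ; have := integrableD mA (int_cst k) (integrableZl mA b intZ).
  by apply: eq_integrable => // x _ /=; rewrite EFinD EFinM.
have intE (Z : T -> R) : P.-integrable A (EFin \o Z) ->
    (\int[P]_(x in A) (k + b * Z x)%:E =
     \int[P]_(x in A) k%:E + b%:E * \int[P]_(x in A) (Z x)%:E)%E.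
  move=> intZ; rewrite -integralZl// -integralD//; last exact: integrableZl.
  exact: int_cst.
have mexp : measurable_fun A (fun x => (expR (t * X x))%:E).
  apply/measurable_EFinP; apply: measurableT_comp => //.
  by apply: measurable_funM => //; apply/measurable_EFinP; exact: measurable_int intAX.
(* The majorant is nonnegative only almost everywhere; the absolute value makes the comparison of
   nonnegative integrands applicable and is removed right after. *)
apply: (@le_trans _ _ (\int[P]_(x in A) `|(k + b * X x)%:E|)%E).
  apply: ae_ge0_le_integral => //.
  - by apply: measurableT_comp => //; exact: measurable_int (int_aff _ intAX).
  - apply: filterS Xcr => x /maj le_kb _.
    by rewrite abse_EFin lee_fin (le_trans le_kb)// ler_norm.
rewrite (_ : integral _ _ _ = \int[P]_(x in A) (k + b * X x)%:E)%E; last first.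
  apply: ae_eq_integral => //.
  - by apply: measurableT_comp => //; exact: measurable_int (int_aff _ intAX).
  - exact: measurable_int (int_aff _ intAX).
  - apply: filterS Xcr => x /maj le_kb _.
    by rewrite gee0_abs// lee_fin (le_trans (expR_ge0 _) le_kb).
rewrite intE// -XY// -intE//.
apply: ae_le_integral => //.
- exact: int_aff.
- exact: int_cst.
(* An upper bound on [Y] suffices because the slope [b] is nonnegative. *)
- apply: filterS Ym => x Yxm; apply: le_trans (kbm m).
  by rewrite lerD2l ler_wpM2l.
Qed.

(** * Exponential moments of sums and the Markov inequality *)

Lemma measurable_sum_seq (d : measure_display) (T : measurableType d)
    (R : realType) (D : set T) (I : eqType) (s : seq I) (h : I -> T -> R) :
  (forall i, i \in s -> measurable_fun D (h i)) ->
  measurable_fun D (fun x => \sum_(i <- s) h i x).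
Proof.
elim: s => [|i s IHs] mh.
  by under eq_fun do rewrite big_nil; exact: measurable_cst.
under eq_fun do rewrite big_cons.
apply: measurable_funD; first by apply: mh; rewrite mem_head.
by apply: IHs => j js; apply: mh; rewrite in_cons js orbT.
Qed.

(* Each factor [expR (X i)] is integrated out conditionally on [F i], with
   respect to which all the other factors are measurable. *)
Lemma integral_expR_sum_le (dsp : measure_display) (T : measurableType dsp)
    (R : realType) (P : probability T R) (I : eqType) (J : seq I)
    (X : I -> T -> R) (F : I -> set_system T) (a : I -> R) :
  uniq J ->
  (forall i, i \in J -> <<s F i >> `<=` measurable) ->
  (forall i, i \in J -> measurable_fun setT (X i)) ->
  (forall i j, i \in J -> j \in J -> j != i ->
    measurable_fun setT (X j : g_sigma_algebraType (F i) -> R)) ->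
  (forall i, i \in J -> forall A, <<s F i >> A ->
    (\int[P]_(x in A) (expR (X i x))%:E <= \int[P]_(x in A) (expR (a i))%:E)%E) ->
  (\int[P]_x (expR (\sum_(i <- J) X i x))%:E <= (expR (\sum_(i <- J) a i))%:E)%E.
Proof.
elim: J => [_ _ _ _ _|i J IHJ /= /andP[iJ uJ] F_sub mX mXF le_a].
  under eq_integral do rewrite big_nil.
  rewrite big_nil integral_cst//. 
  by rewrite [X in (_ * X)%E](probability_setT P) mule1.
have sJ j : j \in J -> j \in i :: J by rewrite in_cons => ->; rewrite orbT.
have ii : i \in i :: J by rewrite mem_head.
have mS : measurable_fun setT (fun x => \sum_(j <- J) X j x).
  by apply: measurable_sum_seq => j /sJ; exact: mX.
under eq_integral do rewrite big_cons addrC expRD.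
apply: (@le_trans _ _
    (\int[P]_x (expR (\sum_(j <- J) X j x) * expR (a i))%:E)%E).
  apply: (ge0_le_integral_weighted _ _ _ P (F i)) => //.
  - exact: F_sub.
  - by apply: measurableT_comp => //; exact: mX.
  - exact: le_a.
  - apply: measurableT_comp => //; apply: measurable_sum_seq => j jJ.
    apply: mXF => //; first exact: sJ.
    by apply: contraNneq iJ => <-.
under eq_integral do rewrite mulrC EFinM.
rewrite ge0_integralZl//; last by apply/measurable_EFinP; exact: measurableT_comp.
rewrite big_cons expRD EFinM lee_wpmul2l ?lee_fin ?expR_ge0//.
apply: IHJ => //.
- by move=> j /sJ; exact: F_sub.
- by move=> j /sJ; exact: mX.
- by move=> j k /sJ jJ /sJ; exact: mXF.
- by move=> j /sJ; exact: le_a.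
Qed.

(** The indicator of [0 <= S] is dominated by [expR (t * S)]. *)
Lemma expR_tail_le (dsp : measure_display) (T : measurableType dsp)
    (R : realType) (P : probability T R) (S : T -> R) (t : R) : 0 <= t ->
  measurable_fun setT S ->
  (P [set x | (0 <= S x)%R] <= \int[P]_x (expR (t * S x))%:E)%E.
Proof.
move=> t0 mS.
have mS0 : measurable [set x | 0 <= S x].
  rewrite -[X in measurable X]setTI; exact: measurable_fun_le.
rewrite -[X in P X]setIT -integral_indic//.
apply: ge0_le_integral => //.
- by apply/measurable_EFinP; exact: measurable_indic.
- apply/measurable_EFinP; apply: measurableT_comp => //.
  exact: measurable_funM.
- move=> x _; rewrite indicE lee_fin; case: (boolP (x \in _)) => [|_].
    by rewrite inE /= => S0; rewrite -expR0 ler_expR mulr_ge0.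
  exact: expR_ge0.
Qed.

(** * Combinatorics of the cycle detection algorithm *)

(** Describes the runs that can occur. The last clause records the exit test of the loop; the lower
    bound on the length of the cycle comes from it. *)
Lemma loop_prob_neq0 (R : realType) (N : nat) (PS : {set 'I_N})
    (E : {set 'I_N * 'I_N}) (s : seq 'I_N) (visited : {set 'I_N}) (v : 'I_N) :
  loop_prob R PS E visited v s != 0 ->
  [/\ path (fun i j => (i, j) \in E) v s,
      {subset s <= PS},
      uniq s,
      forall u, u \in s -> u \notin visited &
      forall u, u \in out_nbrs PS E (last v s) -> (u \in visited) || (u \in s)].
Proof.
elim: s visited v => [|w s IHs] visited v /=.
  case: ifPn => [/eqP avail0 _|_]; last by rewrite eqxx.
  split=> // u uO; rewrite orbF; apply: contraT => uv.
  by have := finset.in_set0 u; rewrite -avail0 inE uv uO.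
case: ifPn => [|_]; last by rewrite eqxx.
rewrite !inE => /andP[w_new /andP[wPS vw]].
rewrite mulf_eq0 negb_or => /andP[_ /IHs[ps sPS us s_new sO]].
split; rewrite ?vw//.
- by move=> u; rewrite inE => /predU1P[->//|/sPS].
- rewrite us andbT; apply/negP => /s_new.
  by rewrite !inE eqxx.
- move=> u; rewrite inE => /predU1P[->//|/s_new].
  by rewrite !inE negb_or => /andP[].
- by move=> u /sO; rewrite !inE -orbA orbCA.
Qed.

Lemma drop_find (T : Type) (p : pred T) (s : seq T) : has p s ->
  exists u s1 s2, [/\ s = s1 ++ u :: s2, drop (find p s) s = u :: s2,
    p u & ~~ has p s1].
Proof.
move=> hs; case: (split_find hs) => u s1 s2 pu s1p.
exists u, s1, s2; rewrite cat_rcons; split=> //.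
by rewrite find_cat (negbTE s1p) /= pu addn0 drop_size_cat.
Qed.

(** When the loop exits, all out-neighbours in [PS] of the last vertex lie on the trace. The cycle
    starts at the earliest of them, so it contains them all and is at least as long as their
    number. *)
Lemma closing_cycleP (R : realType) (N : nat) (PS : {set 'I_N})
    (E : {set 'I_N * 'I_N}) (s : seq 'I_N) :
  (forall v, (0 < #|out_nbrs PS E v|)%N) ->
  trace_prob R PS E s != 0 ->
  let c := closing_cycle PS E s in
  [/\ is_cycle E c, {subset c <= PS} &
      exists v, (#|out_nbrs PS E v| <= size c)%N].
Proof.
move=> O_gt0; case: s => [|v0 s] /=; first by rewrite eqxx.
case: ifPn => [v0PS|_]; last by rewrite eqxx.
rewrite mulf_eq0 negb_or => /andP[_ /loop_prob_neq0[ps sPS us s_new sO]].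
pose O := out_nbrs PS E (last v0 s).
have us0 : uniq (v0 :: s).
  by rewrite /= us andbT; apply/negP => /s_new; rewrite !inE eqxx.
have {sPS}sPS0 : {subset v0 :: s <= PS}.
  by move=> u; rewrite inE => /predU1P[->//|/sPS].
have {}sO u : u \in O -> u \in v0 :: s by move=> /sO; rewrite !inE.
have hasO : has (mem O) (v0 :: s).
  have /card_gt0P[u uO] := O_gt0 (last v0 s).
  by apply/hasP; exists u => //; exact: sO.
have [u [s1 [s2 [sE -> uO s1O]]]] := drop_find _ _ _ hasO.
have ps0 : sorted (fun i j => (i, j) \in E) (v0 :: s) by [].
have last_u : last v0 s = last u s2.
  by rewrite -[LHS]/(last v0 (v0 :: s)) sE last_cat.
rewrite sE in us0 sPS0 sO ps0.
split.
- rewrite /is_cycle; move: us0; rewrite cat_uniq => /and3P[_ _ ->] /=.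
  rewrite rcons_path; apply/andP; split.
    by have [] := cat_sorted2 ps0.
  by move: uO; rewrite /O last_u !inE => /andP[].
- by move=> w wc; apply: sPS0; rewrite mem_cat wc orbT.
- exists (last v0 s); rewrite -/O.
  apply: leq_trans (card_size _); apply: subset_leq_card.
  apply/fintype.subsetP => w wO; have := sO w wO; rewrite mem_cat => /orP[ws1|//].
  by case/negP: s1O; apply/hasP; exists w.
Qed.

(** * Sigma-algebras generated by weights, and the tail bound for a fixed cycle *)

Lemma family_preimages_measurable_fun (R : realType) (T : pointedType)
    (I : Type) (D : set I) (X : I -> T -> R) (F : set_system T) (i : I) :
  family_preimages D X `<=` F -> D i ->
  measurable_fun setT (X i : g_sigma_algebraType F -> R).
Proof.
move=> DF Di _ B mB; apply: sub_sigma_algebra; apply: DF.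
by exists i => //; exists B.
Qed.

Lemma family_preimages_measurable (R : realType) (dsp : measure_display)
    (T : measurableType dsp) (I : Type) (D : set I) (X : I -> T -> R) :
  (forall i, D i -> measurable_fun setT (X i)) ->
  family_preimages D X `<=` measurable.
Proof. by move=> mX A [i Di [B mB <-]]; exact: mX. Qed.

Lemma measurable_sub_sigmaU (dsp : measure_display) (T : measurableType dsp)
    (F G : set_system T) :
  F `<=` measurable -> G `<=` measurable -> <<s F `|` G >> `<=` measurable.
Proof.
move=> mF mG; apply: smallest_sub; first exact: sigma_algebra_measurable.
by move=> A [/mF|/mG].
Qed.

Lemma cycle_tail_le (R : realType) (dsp : measure_display)
    (T : measurableType dsp) (P : probability T R) (N : nat)
    (E : {set 'I_N * 'I_N}) (Dmin Dmax : nat)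
    (wv : 'I_N -> T -> R) (we : 'I_N * 'I_N -> T -> R)
    (Delta : nat) (beta B A alpha : R) (c : seq 'I_N) :
  nicely_weighted P E Dmin Dmax wv we Delta beta B A alpha ->
  is_cycle E c ->
  (P [set x | (0 <= \sum_(v <- c) (we (v, next c v) x - `|wv v x| * Delta%:R))%R]
    <= (expR (- (1 / 2 * ((alpha - beta) / (A + B)) ^+ 2 * (size c)%:R)))%:E)%E.
Proof.
move=> [_ [beta0 betaB] dwell_bnd [A0 alpha_beta] edge_bnd] /and3P[_ uc cyc].
pose dwell l x := `|wv l x| * Delta%:R.
have c_edge v : v \in c -> (v, next c v) \in E by move=> vc; exact: (next_cycle cyc vc).
have m_dwell l : measurable_fun setT (dwell l).
  have [_ [Y [[intX _ _ _] _]]] := dwell_bnd l.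
  exact/measurable_EFinP/(measurable_int _ intX).
have m_we e : e \in E -> measurable_fun setT (we e).
  move=> eE; have [_ [Y [[intX _ _ _] _]]] := edge_bnd e eE.
  exact/measurable_EFinP/(measurable_int _ intX).
(* This [t] minimizes [- t * (beta - alpha) + t ^+ 2 / 2 * (A + B) ^+ 2], an upper bound for the
   exponent contributed by one vertex and its outgoing edge. *)
pose t := (beta - alpha) / (A + B) ^+ 2.
have AB0 : 0 < A + B by lra.
have t0 : 0 <= t by rewrite divr_ge0 ?sqr_ge0//; lra.
(* Vertices and edges share one index type, so that all weights of the cycle form a single list [J].
   [F i] is generated by the weights other than that of [i], and [a i] is the exponent in the
   Hoeffding bound for [X i]. *)
pose I := ('I_N + 'I_N * 'I_N)%type.
pose X (i : I) : T -> R := match i with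
  | inl l => fun x => t * - dwell l x | inr e => fun x => t * we e x end.
pose F (i : I) : set_system T := match i with
  | inl j => family_preimages [set l | l != j] dwell `|`
             family_preimages [set e | e \in E] we
  | inr e => family_preimages setT dwell `|`
             family_preimages [set e' | e' \in E /\ e' != e] we end.
pose a (i : I) : R := match i with
  | inl _ => t * - beta + (t * (B / 2)) ^+ 2 / 2
  | inr _ => t * alpha + (t * A) ^+ 2 / 2 end.
pose J : seq I := [seq inl v | v <- c] ++ [seq inr (v, next c v) | v <- c].
have JP i : i \in J ->
    match i with inl _ => True | inr e => e \in E end.
  by rewrite mem_cat => /orP[|] /mapP[v vc ->]//; exact: c_edge.
have sumJ (f : I -> R) :
    \sum_(i <- J) f i = \sum_(v <- c) (f (inl v) + f (inr (v, next c v))).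
  by rewrite big_cat/= !big_map big_split.
have F_sub i : <<s F i >> `<=` measurable.
  case: i => [j|e]; apply: measurable_sub_sigmaU;
    apply: family_preimages_measurable => //.
  by move=> e' [/m_we].
have mX i : i \in J -> measurable_fun setT (X i).
  move/JP; case: i => [j _|e eE]; apply: measurable_funM => //.
  - by apply: measurableT_comp.
  - exact: m_we.
have mS : measurable_fun setT
    (fun x => \sum_(v <- c) (we (v, next c v) x - dwell v x)).
  apply: measurable_sum_seq => v vc; apply: measurable_funB => //.
  by apply: m_we; exact: c_edge.
apply: (le_trans (expR_tail_le _ _ _ P _ t t0 mS)).
have -> : (fun x => (expR (t * \sum_(v <- c) (we (v, next c v) x - dwell v x)))%:E)
    = (fun x => (expR (\sum_(i <- J) X i x))%:E).
  apply/funext => x; rewrite sumJ mulr_sumr; congr (expR _)%:E.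
  by apply: eq_bigr => v _; rewrite /X; ring.
apply: (le_trans (integral_expR_sum_le _ _ _ P _ J X F a _ _ _ _ _)) => //.
- rewrite cat_uniq !map_inj_uniq ?uc/= ?andbT//; last 2 first.
  + by move=> ? ? [].
  + by move=> ? ? [].
  by apply/hasPn => i /mapP[v _ ->]; apply/negP => /mapP[].
- move=> i j /JP iE /JP; case: i iE => [l _|e eE]; case: j => [l'|e'] //=.
  + move=> _ l'l; apply: measurable_funM => //; apply: measurableT_comp => //.
    apply: (family_preimages_measurable_fun _ _ _ [set k | k != l] dwell) => //.
  + move=> e'E _; apply: measurable_funM => //.
    exact: (family_preimages_measurable_fun _ _ _ [set e | e \in E] we).
  + move=> _ _; apply: measurable_funM => //; apply: measurableT_comp => //.
    exact: (family_preimages_measurable_fun _ _ _ setT dwell).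
  + move=> e'E e'e; apply: measurable_funM => //.
    apply: (family_preimages_measurable_fun _ _ _ [set e' | e' \in E /\ e' != e] we) => //.
- move=> i /JP; case: i => [l _|e eE].
  + have [bnd [Y [XY Ybeta]]] := dwell_bnd l.
    (* The variable [- dwell l] ranges over [[- B, 0]], of centre [- (B / 2)] and radius [B / 2]. *)
    apply: (cond_expectation_mgf_le _ _ _ P _ _ _ (- (B / 2)) _ _ _ (F_sub (inl l))
      (is_cond_expectationN _ _ _ _ _ _ _ (F_sub (inl l)) XY)) => //.
    * by lra.
    * by apply: filterS bnd => x [d0 dB]; rewrite -/(dwell l x) in d0 dB *; lra.
    * by apply: filterS Ybeta => x ->.
  + have [bnd [Y [XY Yalpha]]] := edge_bnd e eE.
    apply: (cond_expectation_mgf_le _ _ _ P _ _ _ 0 _ _ _ (F_sub (inr e)) XY) => //.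
    by apply: filterS bnd => x; rewrite sub0r add0r => -[-> ->].
rewrite lee_fin ler_expR sumJ /a /= big_const_seq count_predT iter_addr_0.
rewrite -[leLHS]mulr_natr -mulNr ler_wpM2r//.
have AB_neq0 : A + B != 0 by rewrite gt_eqF.
have -> : - (1 / 2 * ((alpha - beta) / (A + B)) ^+ 2) =
    - t * (beta - alpha) + t ^+ 2 / 2 * (A + B) ^+ 2.
  by rewrite /t; field.
have B0 : 0 < B by lra.
(* These two signs settle the comparison, since [(A + B) ^+ 2 - (A ^+ 2 + B ^+ 2 / 4) = 2 * A * B +
   3 / 4 * B ^+ 2]. *)
have t2AB : 0 <= t ^+ 2 * (A * B) by rewrite mulr_ge0 ?sqr_ge0// mulr_ge0// ltW.
have t2BB : 0 <= t ^+ 2 * (B * B) by rewrite mulr_ge0 ?sqr_ge0// mulr_ge0// ltW.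
by nra.
Qed.

(** * Decomposition along the values of the trace, and measurability of the outcome *)

(** Composing with [pickle] indexes the fibres of [f] by natural numbers, as countable unions and
    series require; an integer that encodes nothing yields an empty fibre. *)
Lemma preimage_pickleP (T : Type) (U : countType) (f : T -> U) (n : nat) :
  (pickle \o f) @^-1` [set n] = set0 \/
  exists s, (pickle \o f) @^-1` [set n] = f @^-1` [set s].
Proof.
have [[s sn]|no_s] := pselect (exists s : U, pickle s = n).
  right; exists s; apply/seteqP; split=> x /=; last by move=> ->.
  by rewrite -sn => /(pcan_inj (@pickleK U)).
by left; apply/seteqP; split=> // x /= fx; apply: no_s; exists (f x).
Qed.

Lemma bigcup_preimage_pickle (T : Type) (U : countType) (f : T -> U) (A : set T) :
  \bigcup_n ((pickle \o f) @^-1` [set n] `&` A) = A.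
Proof.
apply/seteqP; split=> [x [n _ []]//|x Ax].
by exists (pickle (f x)).
Qed.

Lemma measurable_fibers (dsp : measure_display) (T : measurableType dsp)
    (U : countType) (f : T -> U) (A : set T) :
  (forall s, measurable (f @^-1` [set s] `&` A)) -> measurable A.
Proof.
move=> mA; rewrite -(bigcup_preimage_pickle _ _ f A).
apply: bigcupT_measurable => n.
by case: (preimage_pickleP _ _ f n) => [->|[s ->]//]; rewrite set0I.
Qed.

(** Law of total probability. The product form of the hypothesis avoids dividing by the probability
    of a fibre, which may be zero. *)
Lemma probability_fibers_le (R : realType) (dsp : measure_display)
    (T : measurableType dsp) (P : probability T R) (U : countType)
    (f : T -> U) (A : set T) (eps : R) :
  0 <= eps ->
  (forall s, measurable (f @^-1` [set s])) -> measurable A ->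
  (forall s, P (f @^-1` [set s] `&` A) <= eps%:E * P (f @^-1` [set s]))%E ->
  (P A <= eps%:E)%E.
Proof.
move=> eps0 mf mA le_eps.
pose F n := (pickle \o f) @^-1` [set n].
have mF n : measurable (F n).
  by rewrite /F; case: (preimage_pickleP _ _ f n) => [->|[s ->]].
have PE B : measurable B -> P B = (\sum_(n <oo) P (F n `&` B))%E.
  move=> mB; rewrite -{1}(bigcup_preimage_pickle _ _ f B) measure_semi_bigcup//.
  - by move=> n; exact: (measurableI _ _ (mF n) mB).
  - by apply: (@trivIset_setIr _ _ _ F (fun=> B)); exact: trivIset_preimage1.
  - by apply: bigcupT_measurable => n; exact: (measurableI _ _ (mF n) mB).
have -> : eps%:E = (eps%:E * P setT)%E by rewrite probability_setT mule1.
rewrite (PE A)// (PE setT)// -nneseriesZl//.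
apply: lee_nneseries => // n _; rewrite setIT /F.
case: (preimage_pickleP _ _ f n) => [->|[s ->]]; last exact: le_eps.
by rewrite set0I !measure0 mule0.
Qed.

(** Dwell times on the cycle are at most [Dmax], so the existential over [D] reduces to a finite
    union of events, each given by a measurable strict inequality. *)
Lemma measurable_contractive (R : realType) (dsp : measure_display)
    (T : measurableType dsp) (N : nat) (Dmin Dmax : nat)
    (wv : 'I_N -> T -> R) (we : 'I_N * 'I_N -> T -> R) (c : seq 'I_N) :
  (forall v, measurable_fun setT (wv v)) ->
  (forall e, measurable_fun setT (we e)) ->
  measurable [set x | contractive Dmin Dmax (wv^~ x) (we^~ x) c].
Proof.
move=> m_wv m_we.
pose S (D : {ffun 'I_N -> 'I_Dmax.+1}) x : R :=
  \sum_(v <- c) wv v x * (D v)%:R + \sum_(v <- c) we (v, next c v) x.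
rewrite (_ : [set x | _] = \bigcup_(D in [set D : {ffun 'I_N -> 'I_Dmax.+1} |
    forall v, v \in c -> (Dmin <= D v)%N]) [set x | S D x < 0]).
  apply: fin_bigcup_measurable => [|D _]; first exact: finite_finset.
  rewrite -[X in measurable X]setTI; under eq_set do rewrite -lte_fin.
  apply: measurable_lte => //; apply/measurable_EFinP.
  apply: measurable_funD; apply: measurable_sum_seq => v _ //.
  exact: measurable_funM.
apply/seteqP; split=> x /=.
  (* Off the cycle [D v] may exceed [Dmax], and [inord] then returns a default value; such vertices
     do not occur in the sums. *)
  move=> [D [D_bnd sum_lt0]]; pose D' := [ffun v => inord (D v) : 'I_Dmax.+1].
  have D'E v : v \in c -> D' v = D v :> nat.
    by move=> /D_bnd/andP[_ ?]; rewrite ffunE inordK.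
  exists D' => /=; first by move=> v vc; rewrite D'E//; case/andP: (D_bnd v vc).
  rewrite /S (eq_big_seq (fun v => wv v x * (D v)%:R))// => v vc.
  by rewrite D'E.
move=> [D D_min S_lt0]; exists (fun v => D v : nat); split=> // v vc.
by rewrite D_min// -ltnS ltn_ord.
Qed.

(** * The probability bound for the random output of the algorithm *)

Theorem proposition3 (R : realType) (dsp : measure_display)
    (T : measurableType dsp) (P : probability T R)
    (N d m p : nat)
    (PS PU : {set 'I_N}) (E : {set 'I_N * 'I_N}) (Dmin Dmax : nat)
    (f : T -> 'I_N -> 'cV[R]_d -> 'cV[R]_m -> 'cV[R]_d)
    (h : T -> 'I_N -> 'cV[R]_d -> 'cV[R]_p)
    (lambda : 'I_N -> {RV P >-> R}) (mu : 'I_N * 'I_N -> {RV P >-> R})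
    (Phi : nat -> R) (Delta : nat) (beta B A alpha : R)
    (tr : T -> seq 'I_N) :
  let wv : 'I_N -> T -> R := vertex_weight PS (fun j => lambda j : T -> R) in
  let we : 'I_N * 'I_N -> T -> R := edge_weight (fun e => mu e : T -> R) in
  let K : int := Num.floor (Phi #|PS|) in
  let contractive_output : set T :=
    [set x | let c := closing_cycle PS E (tr x) in
             [/\ is_cycle E c, K <= (size c)%:Z &
                 contractive Dmin Dmax (wv^~ x) (we^~ x) c]] in
  (0 < N)%N ->
  (PS :|: PU)%SET = [set: 'I_N]%SET ->
  (PS :&: PU)%SET = finset.set0 ->
  (forall i j : 'I_N, (i, j) \in E -> i != j) ->
  (forall x i, [set xi | f x i xi 0 = 0] = [set 0]) ->
  (forall x, lyapunov_assumptions PS PU E (f x) (h x)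
               (fun j => lambda j x) (fun e => mu e x)) ->
  (forall a b : nat, (a <= b)%N -> Phi a <= Phi b) ->
  nicely_connected PS E Phi ->
  nicely_weighted P E Dmin Dmax wv we Delta beta B A alpha ->
  detection_run P PS E wv we tr ->
  ((1 - expR (- (1 / 2 * ((alpha - beta) / (A + B)) ^+ 2 * K%:~R)))%:E <=
   P contractive_output)%E.
Proof.
move=> wv we K C N_gt0 _ _ E_irr _ _ _ conn weighted [tr_meas tr_law tr_indep].
set rho := 1 / 2 * ((alpha - beta) / (A + B)) ^+ 2.
have rho0 : 0 <= rho by rewrite mulr_ge0 ?sqr_ge0//; lra.
(* For [K <= 0] the claimed lower bound is at most 0. For [K > 0] every vertex has an out-neighbour
   in [PS], so the closing step always finds a vertex. *)
have [K_le0|K_gt0] := leP K 0.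
  apply: le_trans (measure_ge0 P C); rewrite lee_fin subr_le0 -[leLHS]expR0 ler_expR.
  by rewrite oppr_ge0 mulr_ge0_le0// lerz0.
have m_wv v : measurable_fun setT (wv v).
  rewrite /wv /vertex_weight; case: (v \in PS).
    by do 2! apply: measurableT_comp => //; exact: measurableT_comp.
  by apply: measurableT_comp => //; exact: measurableT_comp.
have m_we e : measurable_fun setT (we e) by exact: measurableT_comp.
have tr_fiber s : preimage_set_system setT tr [set: set (seq 'I_N)]
    (tr @^-1` [set s]).
  by exists [set s] => //; rewrite setTI.
have m_tr s : measurable (tr @^-1` [set s]) by exact: tr_meas.
(* On a fibre of [tr] the cycle is constant, so there [C] is either empty or cut out by
   contractivity of one fixed cycle. *)
have mC : measurable C.
  apply: (measurable_fibers _ _ _ tr) => s; pose c := closing_cycle PS E s.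
  have [c_ok|c_ko] := pselect (is_cycle E c /\ K <= (size c)%:Z).
    rewrite (_ : _ `&` C = tr @^-1` [set s] `&`
        [set x | contractive Dmin Dmax (wv^~ x) (we^~ x) c]).
      by apply: measurableI => //; exact: measurable_contractive.
    apply/seteqP; split=> x [/= xs]; rewrite /C /= xs; first by case.
    by case: c_ok.
  rewrite (_ : _ `&` C = set0)//.
  apply/seteqP; split=> // x [/= xs]; rewrite /C /= xs => -[c1 c2 _].
  exact: c_ko.
have out_gt0 v : (0 < #|out_nbrs PS E v|)%N.
  by rewrite -ltz_nat (lt_le_trans K_gt0)// conn.
suff : (P (~` C) <= (expR (- (rho * K%:~R)))%:E)%E.
  rewrite probability_setC// => le_eps.
  rewrite EFinB leeBlDr// -leeBlDl//; exact: fin_num_measure.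
(* The failure event is bounded separately on each possible trace [s]. *)
apply: (probability_fibers_le _ _ _ P _ tr) => //; first exact: measurableC.
move=> s; have [trace0|trace_neq0] := eqVneq (trace_prob R PS E s) 0.
  have Ptr0 : P (tr @^-1` [set s]) = 0 by rewrite [LHS]tr_law trace0.
  rewrite Ptr0 mule0 -Ptr0 le_measure ?inE//.
  by apply: measurableI => //; exact: measurableC.
have [cyc cPS [v card_le]] := closing_cycleP _ _ _ _ _ out_gt0 trace_neq0.
set c := closing_cycle PS E s in cyc cPS card_le.
have K_le_size : K <= (size c)%:Z.
  by apply: le_trans (conn v) _; rewrite lez_nat.
(* [G] is the event that the constant dwell time [Delta] does not make the fixed cycle [c]
   contractive. It depends on the weights alone, as the independence hypothesis demands. *)
pose G := [set x | 0 <= \sum_(v <- c) (we (v, next c v) x - `|wv v x| * Delta%:R)].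
have c_edge u : u \in c -> (u, next c u) \in E.
  by move: cyc => /and3P[_ _ cyc] uc; exact: (next_cycle cyc uc).
pose F : set_system T := family_preimages setT wv `|`
  family_preimages [set e | e \in E] we.
have FG : <<s F >> G.
  have : measurable (G : set (g_sigma_algebraType F)).
    rewrite -[X in measurable X]setTI; apply: measurable_fun_le => //.
    apply: measurable_sum_seq => u uc; apply: measurable_funB.
      apply: (family_preimages_measurable_fun _ _ _ [set e | e \in E] we).
        exact: subsetUr.
      exact: c_edge.
    apply: measurable_funM => //; apply: measurableT_comp => //.
    apply: (family_preimages_measurable_fun _ _ _ setT wv) => //.
    exact: subsetUl.
  by [].
have mG : measurable G.
  apply: measurable_sub_sigmaU FG; exact: family_preimages_measurable.
have PG : (P G <= (expR (- (rho * K%:~R)))%:E)%E.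
  apply: le_trans (cycle_tail_le _ _ _ _ _ _ _ _ _ _ _ _ _ _ _ _ weighted cyc) _.
  by rewrite lee_fin ler_expR lerN2 ler_wpM2l// [leRHS]pmulrn ler_int.
apply: (@le_trans _ _ (P (tr @^-1` [set s] `&` G))).
  rewrite le_measure ?inE//.
  - by apply: measurableI => //; exact: measurableC.
  - exact: measurableI.
  (* Outside [G] the constant dwell time [Delta] witnesses contractivity: all vertices of [c] are in
     [PS], where [w(u) = -|w(u)|]. *)
  - move=> x [/= xs notC]; split=> //; rewrite /G /= leNgt; apply/negP => S_lt0.
    apply: notC; rewrite /C /= xs; split=> //.
    have [Delta_bnd _ _ _ _] := weighted.
    exists (fun=> Delta); split=> //.
    rewrite -big_split/= (eq_big_seq (fun v =>
      we (v, next c v) x - `|wv v x| * Delta%:R))// => u uc.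
    have wvN : wv u x = - `|wv u x|.
      by rewrite /wv /vertex_weight (cPS u uc) normrN normr_id.
    by rewrite addrC [in LHS]wvN mulNr.
by rewrite tr_indep// muleC lee_wpmul2r.
Qed.
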